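(* Let $\mathsf{L}$ be any of the logics $\mathsf{N}_\preccurlyeq$, $\mathsf{NN}_\preccurlyeq$, $\mathsf{NT}_\preccurlyeq$, $\mathsf{NW}_\preccurlyeq$, $\mathsf{NC}_\preccurlyeq$, $\mathsf{NU}_\preccurlyeq$, $\mathsf{NNU}_\preccurlyeq$, $\mathsf{NTU}_\preccurlyeq$, $\mathsf{NWU}_\preccurlyeq$, $\mathsf{NCU}_\preccurlyeq$, $\mathsf{NA}_\preccurlyeq$, $\mathsf{NNA}_\preccurlyeq$, $\mathsf{NTA}_\preccurlyeq$, $\mathsf{NWA}_\preccurlyeq$, $\mathsf{NCA}_\preccurlyeq$. For every formula $A$, if $A$ is derivable in $\mathsf{L}$, then $A$ is valid in all $\mathsf{L}$-models.
   Context: Language: formulas are given by $A ::= p \mid \bot \mid A\to A \mid A \preccurlyeq A$ with $p$ ranging over a countable set $Atm$ of propositional variables; $\top,\neg,\wedge,\vee$ are defined as usual from $\bot,\to$. A neighbourhood model is $\mathcal M=\langle W,N,V\rangle$ with $W\neq\emptyset$, $V:Atm\to\mathcal P(W)$, and $N:W\to\mathcal P(\mathcal P(W))$ such that $\emptyset\notin N(w)$ for all $w$. Forcing: $w\Vdash p$ iff $w\in V(p)$; $w\not\Vdash\bot$; $w\Vdash B\to C$ iff $w\Vdash B$ implies $w\Vdash C$; $w\Vdash B\preccurlyeq C$ iff for all $\alpha\in N(w)$, if some $v\in\alpha$ has $v\Vdash C$ then some $u\in\alpha$ has $u\Vdash B$. $A$ is valid in $\mathcal M$ if forced at every world, and valid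 in a class if valid in each model of the class. Model conditions (for all $w$): (N) $N(w)\neq\emptyset$; (T) there is $\alpha\in N(w)$ with $w\in\alpha$; (W) $N(w)\neq\emptyset$ and $w\in\alpha$ for all $\alpha\in N(w)$; (C) $\{w\}\in N(w)$ and $w\in\alpha$ for all $\alpha\in N(w)$; (U) if $\alpha\in N(w)$ and $v\in\alpha$ then $\bigcup N(v)=\bigcup N(w)$; (A) if $\alpha\in N(w)$ and $v\in\alpha$ then $N(v)=N(w)$. Axioms and rules: (cpr) from $A\to B$ infer $B\preccurlyeq A$; (tr) $(A\preccurlyeq B)\wedge(B\preccurlyeq C)\to(A\preccurlyeq C)$; (or) $(A\preccurlyeq B)\wedge(A\preccurlyeq C)\to(A\preccurlyeq B\vee C)$; (n) $\neg(\bot\preccurlyeq\top)$; (t) $(\bot\preccurlyeq A)\to\neg A$; (w) $A\to(A\preccurlyeq\top)$; (c) $(A\preccurlyeq\top)\to A$; (u$-$) $\neg(\bot\preccurlyeq A)\to(\bot\preccurlyeq(\bot\preccurlyeq A))$; (u) $(\bot\preccurlyeq A)\to(\bot\preccurlyeq\neg(\bot\preccurlyeq A))$; (a$-$) $(A\preccurlyeq B)\to(\bot\preccurlyeq\neg(A\preccurlyeq B))$; (a) $\neg(A\preccurlyeq B)\to(\bot\preccurlyeq(A\preccurlyeq B))$. Logics: $\mathsf{N}_\preccurlyeq$ = classical propositional logic (in this language) plus tr, or, cpr; $\mathsf{NN}_\preccurlyeq=\mathsf N_\preccurlyeq+$n; $\mathsf{NT}_\preccurlyeq=\mathsf N_\preccurlyeq+$t;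 $\mathsf{NW}_\preccurlyeq=\mathsf{NT}_\preccurlyeq+$w; $\mathsf{NC}_\preccurlyeq=\mathsf{NW}_\preccurlyeq+$c; for each such $\mathsf{L}$ (written $\mathsf{N}X_\preccurlyeq$), $\mathsf{N}XU_\preccurlyeq=\mathsf L+$u$-$,u and $\mathsf{N}XA_\preccurlyeq=\mathsf L+$a$-$,a. $A$ is derivable in $\mathsf L$ if there is a finite sequence ending in $A$ each element of which is an axiom of $\mathsf L$ or follows from earlier ones by modus ponens or cpr. An $\mathsf L$-model is a neighbourhood model satisfying the conditions named by the letters after the initial N in the name of $\mathsf L$ (e.g. $\mathsf{NTU}_\preccurlyeq$-models satisfy (T) and (U); $\mathsf N_\preccurlyeq$-models are all neighbourhood models). *)

(* Defs.v *)
From mathcomp Require Import ssreflect ssrfun ssrbool eqtype ssrnat seq choice.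
From mathcomp Require Import boolp classical_sets.
From Stdlib Require List.

Set Implicit Arguments.
Unset Strict Implicit.
Unset Printing Implicit Defensive.

Local Open Scope classical_set_scope.

Inductive form (Atm : countType) : Type :=
| Var of Atm
| Bot
| Imp of form Atm & form Atm
| Pref of form Atm & form Atm.

Arguments Bot {Atm}.

Declare Scope nform_scope.
Delimit Scope nform_scope with nform.
Bind Scope nform_scope with form.

Notation "A ⊃ B" := (Imp A B) (at level 60, right associativity) : nform_scope.
Notation "A ≼ B" := (Pref A B) (at level 50, no associativity) : nform_scope.
Notation "⊥" := Bot : nform_scope.

Definition Neg (Atm : countType) (A : form Atm) : form Atm := (A ⊃ ⊥)%nform.
Definition Top {Atm : countType} : form Atm := (⊥ ⊃ ⊥)%nform.
Notation "¬ A" := (Neg A) (at level 35, right associativity) : nform_scope.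
Notation "⊤" := Top : nform_scope.
Definition And (Atm : countType) (A B : form Atm) : form Atm :=
  (¬ (A ⊃ ¬ B))%nform.
Definition Or (Atm : countType) (A B : form Atm) : form Atm :=
  (¬ A ⊃ B)%nform.
Notation "A ∧ B" := (And A B) (at level 55, right associativity) : nform_scope.
Notation "A ∨ B" := (Or A B) (at level 57, right associativity) : nform_scope.

Record nmodel (Atm : countType) := NModel {
  world : Type;
  world_nonempty : inhabited world;
  nbh : world -> set (set world);
  set0_notin_nbh : forall w : world, ~ nbh w set0;
  valuation : Atm -> set world
}.

Arguments nbh {Atm} M w : rename.
Arguments valuation {Atm} M p : rename.

Fixpoint forces (Atm : countType) (M : nmodel Atm) (w : world M)
    (A : form Atm) : Prop :=
  match A with
  | Var p => valuation M p w
  | Bot => False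
  | Imp B C => forces w B -> forces w C
  | Pref B C => forall a : set (world M), nbh M w a ->
      (exists2 v, a v & forces v C) -> exists2 u, a u & forces u B
  end.

Definition valid (Atm : countType) (M : nmodel Atm) (A : form Atm) : Prop :=
  forall w : world M, forces w A.

Definition valid_in (Atm : countType) (K : set (nmodel Atm)) (A : form Atm) :
  Prop := forall M, K M -> valid M A.

Section Conditions.
Variables (Atm : countType) (M : nmodel Atm).

Definition cond_N := forall w, nbh M w !=set0.
Definition cond_T := forall w, exists2 a, nbh M w a & a w.
Definition cond_W :=
  forall w, nbh M w !=set0 /\ forall a, nbh M w a -> a w.
Definition cond_C :=
  forall w, nbh M w [set w] /\ forall a, nbh M w a -> a w.
Definition cond_U := forall w a v, nbh M w a -> a v ->
  \bigcup_(b in nbh M v) b = \bigcup_(b in nbh M w) b.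
Definition cond_A := forall w a v, nbh M w a -> a v -> nbh M v = nbh M w.

End Conditions.

(* The fifteen logics are the pairs of a base system, named by the letter after
   the initial N (BaseO when there is none), and an extension by nothing, by
   (u-) and (u), or by (a-) and (a). *)
Inductive base := BaseO | BaseN | BaseT | BaseW | BaseC.
Inductive ext := ExtO | ExtU | ExtA.
Record logic := Logic { lbase : base; lext : ext }.

Definition logic_model (Atm : countType) (L : logic) : set (nmodel Atm) :=
  fun M =>
    match lbase L with
    | BaseO => True
    | BaseN => cond_N M
    | BaseT => cond_T M
    | BaseW => cond_W M
    | BaseC => cond_C M
    end /\
    match lext L with
    | ExtO => True
    | ExtU => cond_U M
    | ExtA => cond_A M
    end.

(* Classical truth value of A when variables and formulas B ≼ C are both
   treated as propositional atoms. *)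
Fixpoint teval (Atm : countType) (e : Atm -> bool)
    (f : form Atm -> form Atm -> bool) (A : form Atm) : bool :=
  match A with
  | Var p => e p
  | Bot => false
  | Imp B C => teval e f B ==> teval e f C
  | Pref B C => f B C
  end.

Definition tautology (Atm : countType) (A : form Atm) : Prop :=
  forall e f, teval e f A.

Definition has_n (b : base) : bool := if b is BaseN then true else false.
Definition has_t (b : base) : bool :=
  match b with BaseT | BaseW | BaseC => true | _ => false end.
Definition has_w (b : base) : bool :=
  match b with BaseW | BaseC => true | _ => false end.
Definition has_c (b : base) : bool := if b is BaseC then true else false.

Inductive logic_axiom (Atm : countType) (L : logic) : form Atm -> Prop :=
| ax_cpl A : tautology A -> logic_axiom L A
| ax_tr A B C : logic_axiom L ((A ≼ B) ∧ (B ≼ C) ⊃ (A ≼ C))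
| ax_or A B C : logic_axiom L ((A ≼ B) ∧ (A ≼ C) ⊃ (A ≼ (B ∨ C)))
| ax_n : has_n (lbase L) -> logic_axiom L (¬ (⊥ ≼ ⊤))
| ax_t A : has_t (lbase L) -> logic_axiom L ((⊥ ≼ A) ⊃ ¬ A)
| ax_w A : has_w (lbase L) -> logic_axiom L (A ⊃ (A ≼ ⊤))
| ax_c A : has_c (lbase L) -> logic_axiom L ((A ≼ ⊤) ⊃ A)
| ax_u_minus A : lext L = ExtU -> logic_axiom L (¬ (⊥ ≼ A) ⊃ (⊥ ≼ (⊥ ≼ A)))
| ax_u A : lext L = ExtU -> logic_axiom L ((⊥ ≼ A) ⊃ (⊥ ≼ ¬ (⊥ ≼ A)))
| ax_a_minus A B : lext L = ExtA -> logic_axiom L ((A ≼ B) ⊃ (⊥ ≼ ¬ (A ≼ B)))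
| ax_a A B : lext L = ExtA -> logic_axiom L (¬ (A ≼ B) ⊃ (⊥ ≼ (A ≼ B))).

Inductive justified (Atm : countType) (L : logic) (s : seq (form Atm)) :
    form Atm -> Prop :=
| just_ax A : logic_axiom L A -> justified L s A
| just_mp A B : List.In (A ⊃ B)%nform s -> List.In A s -> justified L s B
| just_cpr A B : List.In (A ⊃ B)%nform s -> justified L s (B ≼ A).

Definition derivation (Atm : countType) (L : logic) (s : seq (form Atm)) :
    Prop :=
  forall s1 B s2, s = s1 ++ B :: s2 -> justified L s1 B.

Definition derivable (Atm : countType) (L : logic) (A : form Atm) : Prop :=
  exists s, derivation L (rcons s A).

(* Main.v *)
Require Import Defs.
From mathcomp Require Import ssreflect ssrfun ssrbool eqtype ssrnat seq choice.
From mathcomp Require Import boolp classical_sets.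

Set Implicit Arguments.
Unset Strict Implicit.
Unset Printing Implicit Defensive.

Local Open Scope classical_set_scope.

(** Soundness goes by induction along the derivation, in a fixed model: axioms are valid under the
    matching condition, and both rules preserve validity. The modal axioms rest on reading [⊥ ≼ A]
    at w as: A fails throughout the union of N(w) ([forces_BotPref]). Under (U) this union is the
    same at each of its own points, so the truth value of [⊥ ≼ A] is constant there; under (A) the
    whole of N is constant there, and so is the truth value of any [A ≼ B]. This gives the u and a
    axioms. *)

Section Forcing.
Variables (Atm : countType) (M : nmodel Atm).
Implicit Types (w v : world M) (A B C : form Atm).

Lemma forces_And w A B : forces w (A ∧ B) <-> forces w A /\ forces w B.
Proof.
split=> /= [nAB|[wA wB] nAB]; last exact: nAB.
by split; apply: contrapT => nX; apply: nAB => wA wB; apply: nX.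
Qed.

Lemma forces_Or w A B : forces w (A ∨ B) <-> forces w A \/ forces w B.
Proof.
split=> /= [nAB|[wA /(_ wA)|]] //.
by have [wA|/nAB wB] := pselect (forces w A); [left|right].
Qed.

Lemma forces_BotPref w A :
  forces w (⊥ ≼ A) <->
  forall v, (\bigcup_(a in nbh M w) a) v -> ~ forces v A.
Proof.
split=> /= [wA v [a wa av] vA|wA a wa [v av vA]].
  by have [|u] := wA a wa; first by exists v.
by case: (wA v) => //; exists a.
Qed.

(** Forcing at w is itself a Boolean assignment to variables and ≼-formulas, and it commutes with ⊥
    and ⊃. *)
Lemma forces_tautology w A : tautology A -> forces w A.
Proof.
pose e p := `[< forces w (Var p) >].
pose f B C := `[< forces w (B ≼ C)%nform >].
move=> /(_ e f).
have -> : teval e f A = `[< forces w A >]; last by move/asboolP.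
elim: A => //= [|B -> C ->]; first by rewrite asboolF.
by rewrite asbool_imply.
Qed.

(** The systems with w or c keep the weaker axioms; the chain from (C) to (W) to (T) lets each axiom
    be checked under the weakest relevant condition. *)
Lemma cond_W_T : cond_W M -> cond_T M.
Proof. by move=> MW w; have [[a wa] wW] := MW w; exists a => //; apply: wW. Qed.

Lemma cond_C_W : cond_C M -> cond_W M.
Proof. by move=> MC w; have [wC ?] := MC w; split=> //; exists [set w]. Qed.

Lemma valid_Imp A B : (forall w, forces w A -> forces w B) -> valid M (A ⊃ B).
Proof. by []. Qed.

Lemma valid_tr A B C : valid M ((A ≼ B) ∧ (B ≼ C) ⊃ (A ≼ C)).
Proof.
by apply: valid_Imp => w /forces_And[AB BC] a wa /(BC a wa)/(AB a wa).
Qed.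

Lemma valid_or A B C : valid M ((A ≼ B) ∧ (A ≼ C) ⊃ (A ≼ (B ∨ C))).
Proof.
apply: valid_Imp => w /forces_And[wAB wAC] a wa [v av /forces_Or[vB|vC]].
  by apply: wAB wa _; exists v.
by apply: wAC wa _; exists v.
Qed.

Lemma valid_n : cond_N M -> valid M (¬ (⊥ ≼ ⊤)).
Proof.
move=> MN; apply: valid_Imp => w /forces_BotPref w0; have [a wa] := MN w.
(* No neighbourhood is empty, so [a] has a point v; ⊤ holds there. *)
have [a0|/set0P[v av]] := eqVneq a set0.
  by case: (@set0_notin_nbh _ M w); rewrite -a0.
by apply: (w0 v) => //; exists a.
Qed.

Lemma valid_t A : cond_T M -> valid M ((⊥ ≼ A) ⊃ ¬ A).
Proof.
move=> MT; apply: valid_Imp => w /forces_BotPref wA.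
by have [a wa aw] := MT w; apply: wA; exists a.
Qed.

Lemma valid_w A : cond_W M -> valid M (A ⊃ (A ≼ ⊤)).
Proof. by move=> MW w wA a wa _; exists w => //; apply: (MW w).2. Qed.

Lemma valid_c A : cond_C M -> valid M ((A ≼ ⊤) ⊃ A).
Proof.
move=> MC w wA; have [wC _] := MC w.
(* In the neighbourhood {w}, the world forcing A can only be w. *)
by have [|u -> //] := wA _ wC; exists w.
Qed.

Lemma cond_U_forces_BotPref w v A : cond_U M ->
  (\bigcup_(a in nbh M w) a) v -> forces v (⊥ ≼ A) <-> forces w (⊥ ≼ A).
Proof. by move=> MU [a wa av]; rewrite !forces_BotPref (MU _ _ _ wa av). Qed.

Lemma cond_A_forces_Pref w v A B : cond_A M ->
  (\bigcup_(a in nbh M w) a) v -> forces v (A ≼ B) <-> forces w (A ≼ B).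
Proof. by move=> MA [a wa av] /=; rewrite (MA _ _ _ wa av). Qed.

Lemma valid_u_minus A : cond_U M -> valid M (¬ (⊥ ≼ A) ⊃ (⊥ ≼ (⊥ ≼ A))).
Proof.
move=> MU; apply: valid_Imp => w wA.
by apply/forces_BotPref => v /(cond_U_forces_BotPref A MU) ->.
Qed.

Lemma valid_u A : cond_U M -> valid M ((⊥ ≼ A) ⊃ (⊥ ≼ ¬ (⊥ ≼ A))).
Proof.
move=> MU; apply: valid_Imp => w wA; apply/forces_BotPref => v wv; apply.
by apply/(cond_U_forces_BotPref A MU wv).
Qed.

Lemma valid_a_minus A B : cond_A M -> valid M ((A ≼ B) ⊃ (⊥ ≼ ¬ (A ≼ B))).
Proof.
move=> MA; apply: valid_Imp => w wAB; apply/forces_BotPref => v wv; apply.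
by apply/(cond_A_forces_Pref A B MA wv).
Qed.

Lemma valid_a A B : cond_A M -> valid M (¬ (A ≼ B) ⊃ (⊥ ≼ (A ≼ B))).
Proof.
move=> MA; apply: valid_Imp => w wAB.
by apply/forces_BotPref => v /(cond_A_forces_Pref A B MA) ->.
Qed.

Lemma valid_logic_axiom L A : logic_model L M -> logic_axiom L A -> valid M A.
Proof.
case: L => b e [/= Mb Me]; case=> /= {A}.
- by move=> A At w; apply: forces_tautology.
- exact: valid_tr.
- exact: valid_or.
- by case: b Mb => //= MN _; apply: valid_n.
- move=> A bt; apply: valid_t; case: b Mb bt => //= [/cond_W_T //|].
  by move=> /cond_C_W/cond_W_T.
- by move=> A bw; apply: valid_w; case: b Mb bw => //= /cond_C_W.
- by move=> A; case: b Mb => //= MC _; apply: valid_c.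
- by move=> A eU; rewrite eU in Me; apply: valid_u_minus.
- by move=> A eU; rewrite eU in Me; apply: valid_u.
- by move=> A B eA; rewrite eA in Me; apply: valid_a_minus.
- by move=> A B eA; rewrite eA in Me; apply: valid_a.
Qed.

(** Premises must be valid in the whole model, not just at w: cpr uses the implication at a point v
    of a neighbourhood of w. *)
Lemma valid_justified L s A : logic_model L M ->
  (forall B, List.In B s -> valid M B) -> justified L s A -> valid M A.
Proof.
move=> ML sM; case=> {A} [A|A B /sM AB /sM MA w|A B /sM AB w a _ [v av vA]].
- exact: valid_logic_axiom.
- exact: AB (MA w).
- by exists v => //; apply: AB.
Qed.

End Forcing.

Lemma In_rcons (T : Type) (s : seq T) (x y : T) :
  List.In y (rcons s x) -> List.In y s \/ y = x.
Proof.
elim: s => [[->|//]|z s IHs /= [->|/IHs[]]]; first by right.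
- by left; left.
- by left; right.
- by right.
Qed.

(** A splitting of [s] becomes one of [rcons s A] by lengthening its tail, with the same earlier
    entries; the empty tail gives the last entry. *)
Lemma derivation_rcons (Atm : countType) (L : logic) (s : seq (form Atm)) A :
  derivation L (rcons s A) -> derivation L s /\ justified L s A.
Proof.
move=> sA; split=> [s1 B s2 sE|]; last by apply: (sA _ _ [::]); rewrite cats1.
by apply: (sA _ _ (rcons s2 A)); rewrite sE rcons_cat.
Qed.

Lemma valid_derivation (Atm : countType) (M : nmodel Atm) L s A :
  logic_model L M -> derivation L s -> List.In A s -> valid M A.
Proof.
move=> ML; elim/last_ind: s A => [//|s B IHs] A /derivation_rcons[sL sB].
have {}IHs C : List.In C s -> valid M C by apply: IHs.
by move=> sBA; case: (In_rcons sBA) => [/IHs //| ->]; apply: valid_justified sB.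
Qed.

Theorem theorem3p2 (Atm : countType) (L : logic) (A : form Atm) :
  derivable L A -> valid_in (logic_model L) A.
Proof.
move=> [s /derivation_rcons[sL sA]] M ML.
by apply: valid_justified sA => // B; apply: valid_derivation sL.
Qed.
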